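(* Let $1\le p<\infty$ and let $(X,d)$ be a finite metric space. Let $P$ be an irreducible and aperiodic Markov transition kernel from $X$ to itself, and let $\nu_\infty$ be its stationary distribution. For any initial distribution $\nu$ on $X$, let $(Y_i)_{i\in\mathbb{N}}$ denote the Markov chain with initial distribution $\nu$ and transition kernel $P$, and for $n\in\mathbb{N}$ let $\bar\nu_n=\frac1n\sum_{i=1}^n\delta_{Y_i}$ denote the empirical measure of $Y_1,\dots,Y_n$. Then $\rho(F_p(\bar\nu_n),F_p(\nu_\infty))\to0$ almost surely as $n\to\infty$.
   Context: For a probability measure $\nu$ on the finite metric space $X$, $F_p(\nu)=\arg\min_{x\in X}\int_X d^p(x,y)\,d\nu(y)$ (a non-empty finite set). For non-empty compact sets $C,C'\subseteq X$, $\rho(C,C')=\max_{x\in C}\min_{x'\in C'}d(x,x')$. *)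

(* Defs.v *)
From HB Require Import structures.
From mathcomp Require Import all_boot all_order all_algebra.
From mathcomp Require Import all_classical all_reals all_analysis.

Set Implicit Arguments.
Unset Strict Implicit.
Unset Printing Implicit Defensive.
Import Order.TTheory GRing.Theory Num.Theory.
Import numFieldNormedType.Exports.

Local Open Scope classical_set_scope.
Local Open Scope ring_scope.
Local Open Scope ereal_scope.

(* Non-emptiness (Pointed) is required by the library's measurable types; it is
   no restriction here, since an empty space carries no probability measure. *)
#[short(type="finMetricType")]
HB.structure Definition FinMetric (R : numDomainType) :=
  {X of Metric R X & Finite X & Pointed X}.

(* On a finite metric space the Borel sigma-algebra is the full power set. *)
Notation borel X := (g_sigma_algebraType (@open X)).

Section Frechet.
Variables (R : realType) (X : finMetricType R).

Definition frechet_mean (p : R) (nu : {measure set (borel X) -> \bar R}) :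
    set X :=
  [set x : X | forall z : X,
     \int[nu]_(y in [set: borel X]) ((mdist x (y : X) : R) `^ p)%:E <=
     \int[nu]_(y in [set: borel X]) ((mdist z (y : X) : R) `^ p)%:E].

(* Extended-real valued only so that the max and min over the empty set make
   sense; the value is a real number whenever C and C' are non-empty. *)
Definition rho (C C' : set X) : \bar R :=
  \big[maxe/-oo]_(x in C) \big[mine/+oo]_(x' in C') (mdist x x')%:E.

(* The empirical measure of the n points y 0, ..., y (n - 1); for n = 0 it is the
   zero measure, not a probability measure. *)
Definition empirical (y : nat -> X) (n : nat) :
    {measure set (borel X) -> \bar R} :=
  mscale (n%:R^-1)%:nng%R (msum (fun i => \d_(y i : borel X)) n).

End Frechet.

Section MarkovChains.
Variables (R : realType) (X : finMetricType R).
Variable P : R.-pker (borel X) ~> (borel X).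

Fixpoint kiter (n : nat) (x : borel X) (A : set (borel X)) : \bar R :=
  if n is m.+1 then \int[P x]_z kiter m z A else \d_x A.

Definition irreducible : Prop :=
  forall x y : borel X, exists2 n : nat, (0 < n)%N & 0 < kiter n x [set y].

(* The greatest common divisor of the possible return times to x is 1. *)
Definition aperiodic : Prop :=
  forall (x : borel X) (g : nat),
    (forall n : nat, (0 < n)%N -> 0 < kiter n x [set x] -> (g %| n)%N) ->
    g = 1%N.

Definition stationary (nu : probability (borel X) R) : Prop :=
  forall A : set (borel X), measurable A -> nu A = \int[nu]_x P x A.

(* The chain is indexed from 0, so Y i is the (i+1)-st variable of the chain.
   The Markov property is the identity
     Pr(Y_(n+1) = z | Y_0 = x_0, ..., Y_n = x_n) = P(x_n, {z}),
   multiplied out so that conditioning on null events is harmless. *)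
Definition markov_chain (d : measure_display) (Omega : measurableType d)
    (Pr : probability Omega R) (Y : nat -> {RV Pr >-> borel X})
    (nu : probability (borel X) R) : Prop :=
  (forall A : set (borel X), measurable A -> distribution Pr (Y 0%N) A = nu A) /\
  (forall (n : nat) (x : nat -> X) (z : X),
     Pr [set w | (forall i, (i <= n)%N -> Y i w = x i) /\ Y n.+1 w = z] =
     Pr [set w | forall i, (i <= n)%N -> Y i w = x i] * P (x n) [set z]).

End MarkovChains.

(* Main.v *)
(* Let M_n(z) be the sum over i < n of 1{Y_(i+1) = z} - P(Y_i, z).  By the Markov
   property its increments are bounded and orthogonal, so E[M_n(z)^2] <= n; hence
   M_n(z)/n tends to 0 almost surely along the squares, and then along all n
   because |M_(n+1)(z) - M_n(z)| <= 1.  The occupation frequencies m_n thus satisfy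
   m_n - m_n P -> 0, and as irreducibility makes I - P injective on vectors of sum
   zero, m_n tends to the stationary distribution.  So the Frechet functionals
   converge pointwise; on a finite space the minimisers of the n-th functional
   are then eventually minimisers of the limit, and rho is eventually 0. *)

Require Import Defs.
From mathcomp Require Import all_boot all_order all_algebra.
From mathcomp Require Import all_classical all_reals all_analysis.
From mathcomp Require Import measurable_realfun ring lra zify.
Import Order.TTheory GRing.Theory Num.Theory.
Import numFieldNormedType.Exports.
Local Open Scope classical_set_scope.
Local Open Scope ring_scope.

(** * Irreducible stochastic matrices on a finite set *)

Section StochasticMatrix.
Context {R : realFieldType} {X : finType} (p : X -> X -> R).

Fixpoint transition (n : nat) (x y : X) : R :=
  if n is m.+1 then \sum_z p x z * transition m z y else (x == y)%:R.

Definition left_invariant (v : X -> R) := forall y, \sum_x v x * p x y = v y.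

Lemma invariant_transition v n y : left_invariant v ->
  \sum_x v x * transition n x y = v y.
Proof.
move=> iv; elim: n y => [|n IHn] y /=.
  rewrite (bigD1 y)//= eqxx mulr1 big1 ?addr0// => x /negbTE ->.
  by rewrite mulr0.
under eq_bigr do rewrite mulr_sumr.
rewrite exchange_big/= -[RHS]IHn; apply: eq_bigr => z _.
under eq_bigr do rewrite mulrA.
by rewrite -mulr_suml iv.
Qed.

Hypothesis p_ge0 : forall x y, 0 <= p x y.
Hypothesis p_sum1 : forall x, \sum_y p x y = 1.
Hypothesis p_irr : forall x y, exists n, 0 < transition n x y.

Lemma transition_ge0 n x y : 0 <= transition n x y.
Proof.
elim: n x => [|n IHn] x /=; first exact: ler0n.
by apply: sumr_ge0 => z _; exact: mulr_ge0.
Qed.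

(** By irreducibility some power of [p] is positive at [(x, y)]. The value [v y = 0] is a sum of
    non-negative terms, among them [v x] times this positive entry. *)
Lemma invariant_eq0 v y : left_invariant v -> (forall x, 0 <= v x) -> v y = 0 ->
  forall x, v x = 0.
Proof.
move=> iv v0 vy x; have [n n0] := p_irr x y.
have /eqP := invariant_transition v n y iv; rewrite vy.
rewrite psumr_eq0; last by move=> z _; rewrite mulr_ge0// transition_ge0.
move=> /allP/(_ x (mem_index_enum _)) /=.
by rewrite mulf_eq0 (gt_eqF n0) orbF => /eqP.
Qed.

(* Summing [|v y| <= \sum_x |v x| p x y] over [y] gives an equality, so every
   one of these inequalities is an equality. *)
Lemma invariant_norm v : left_invariant v -> left_invariant (fun x => `|v x|).
Proof.
move=> iv y; pose D y := \sum_x `|v x| * p x y - `|v y|.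
have D0 z : 0 <= D z.
  rewrite subr_ge0 -[in leLHS]iv (le_trans (ler_norm_sum _ _ _))//.
  by apply: ler_sum => x _; rewrite normrM (ger0_norm (p_ge0 _ _)).
have : \sum_z D z == 0.
  rewrite sumrB exchange_big/= subr_eq0; apply/eqP; apply: eq_bigr => x _.
  by rewrite -mulr_sumr p_sum1 mulr1.
rewrite psumr_eq0// => /allP/(_ y (mem_index_enum _)) /=.
by rewrite subr_eq0 => /eqP.
Qed.

(** Both [|v| + v] and [|v| - v] are invariant and non-negative, and one of them vanishes at [x],
    hence everywhere. So [v] has constant sign, and sum zero forces it to vanish. *)
Lemma invariant_sum0 v : left_invariant v -> \sum_x v x = 0 -> forall x, v x = 0.
Proof.
move=> iv v0 x.
have ipm (b : bool) : left_invariant (fun x => `|v x| + (-1) ^+ b * v x).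
  move=> y; under eq_bigr do rewrite mulrDl -mulrA.
  by rewrite big_split/= -mulr_sumr iv invariant_norm.
have pm0 (b : bool) z : 0 <= `|v z| + (-1) ^+ b * v z.
  have := ler_norm (v z); have := ler_normr (v z) (- v z).
  by case: b; rewrite /= ?expr1 ?expr0; have := ler_norm (- v z); rewrite normrN; lra.
have [b vb] : exists b : bool, `|v x| + (-1) ^+ b * v x = 0.
  case: (lerP (v x) 0) => [vx|/ltW vx].
    by exists false; rewrite ler0_norm// expr0; lra.
  by exists true; rewrite ger0_norm// expr1; lra.
have /= Z := invariant_eq0 _ _ (ipm b) (pm0 b) vb.
have : \sum_z `|v z| = 0.
  have -> : \sum_z `|v z| = \sum_z (`|v z| + (-1) ^+ b * v z).
    by rewrite big_split/= -mulr_sumr v0 mulr0 addr0.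
  by rewrite big1.
move/eqP; rewrite psumr_eq0// => /allP/(_ x (mem_index_enum _)) /=.
by rewrite normr_eq0 => /eqP.
Qed.

(* The matrix [1 - p + J], with [J] the all-ones matrix, is invertible, and its
   inverse is the required [b]. *)
Lemma fundamental_matrix : exists b : X -> X -> R, forall v,
  \sum_x v x = 0 ->
  forall x, v x = \sum_y (v y - \sum_z v z * p z y) * b y x.
Proof.
pose M : 'M[R]_#|X| := \matrix_(i, j)
  ((i == j)%:R - p (enum_val i) (enum_val j) + 1).
have sumE (f : X -> R) : \sum_(i < #|X|) f (enum_val i) = \sum_x f x.
  by rewrite -(big_enum_val f).
have ME (v : X -> R) j : ((\row_i v (enum_val i)) *m M) 0 j =
    v (enum_val j) - \sum_x v x * p x (enum_val j) + \sum_x v x.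
  rewrite !mxE -(sumE (fun x => v x * p x _)) -(sumE v).
  under eq_bigr do rewrite !mxE mulrDr mulr1 mulrBr.
  rewrite big_split/= sumrB; congr (_ - _ + _).
  rewrite (bigD1 j)//= eqxx mulr1 big1 ?addr0// => i /negbTE ->.
  by rewrite mulr0.
have : row_free M.
  apply: inj_row_free => w wM.
  pose v x := w 0 (enum_rank x).
  have wE : w = \row_i v (enum_val i).
    by apply/rowP => i; rewrite mxE /v enum_valK.
  have E y : v y - \sum_x v x * p x y + \sum_x v x = 0.
    by rewrite -(enum_rankK y) -ME -wE wM mxE.
  have s0 : \sum_x v x = 0.
    apply/eqP; case: (posnP #|X|) => [/card0_eq X0|Xgt0].
      by rewrite big1// => x; have := X0 x; rewrite inE.
    (* Summing [E] over [y], the first two terms cancel because the rows of [p] sum to 1; what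
       remains is [#|X|] times the sum of [v]. *)
    have : \sum_y (v y - \sum_x v x * p x y + \sum_x v x) = 0.
      by rewrite big1.
    rewrite big_split/= sumrB exchange_big/=.
    under [X in _ - X]eq_bigr do rewrite -mulr_sumr p_sum1 mulr1.
    rewrite subrr add0r sumr_const => /eqP.
    by rewrite mulrn_eq0 (gtn_eqF Xgt0).
  have iv : left_invariant v.
    by move=> y; have := E y; rewrite s0 addr0 => /eqP; rewrite subr_eq0 => /eqP.
  by apply/rowP => i; rewrite wE !mxE invariant_sum0.
move=> /row_freeP[B MB].
exists (fun y x => B (enum_rank y) (enum_rank x)) => v v0 x.
(* On vectors of sum zero [J] acts as 0, so [v M] is the residual [v - v p]; multiplying by [B]
   recovers [v]. *)
have := congr1 (fun m : 'rV[R]_#|X| => m 0 (enum_rank x))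
  (mulmxA (\row_i v (enum_val i)) M B).
rewrite /= MB mulmx1 mxE enum_rankK => ->.
rewrite mxE -[RHS](sumE (fun y => (v y - _) * B (enum_rank y) _)).
by apply: eq_bigr => i _; rewrite ME v0 addr0 enum_valK.
Qed.

End StochasticMatrix.

(** * Measures and kernels on a finite metric space as vectors and matrices *)

Lemma finite_metric_open {R : realType} (X : finMetricType R) (A : set X) :
  open A.
Proof.
rewrite -(setCK A); apply: closed_openC.
have /accessible_finite_set_closed := hausdorff_accessible (@metric_hausdorff R X).
apply; exact: finite_finset.
Qed.

Lemma borel_measurable {R : realType} (X : finMetricType R)
  (A : set (borel X)) : measurable A.
Proof. by apply: sub_sigma_algebra; exact: finite_metric_open. Qed.

Section FiniteRange.
Context {d : measure_display} {Omega : measurableType d} {F : finType}.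
Variables (T : Omega -> F) (mT : forall t, measurable (T @^-1` [set t])).

Lemma measurable_finite_range {R : realType} (H : F -> \bar R) :
  measurable_fun setT (H \o T).
Proof.
move=> _ B mB; rewrite setTI.
rewrite (_ : _ @^-1` B = \bigcup_(t in H @^-1` B) (T @^-1` [set t])).
  by apply: fin_bigcup_measurable => //; exact: finite_finset.
by apply/seteqP; split => [w Bw|w [t Bt]] /=; [exists (T w)|move=> ->].
Qed.

(** The fibres of [T] partition [Omega] into finitely many measurable sets, and the integrand is
    constant on each. *)
Lemma integral_finite_range {R : realType}
    (mu : {measure set Omega -> \bar R}) (H : F -> \bar R) :
  (forall t, 0 <= H t)%E ->
  (\int[mu]_w H (T w) = \sum_t H t * mu (T @^-1` [set t]))%E.
Proof.
move=> H0.
have E : [set: Omega] = \big[setU/set0]_(t <- index_enum F) (T @^-1` [set t]).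
  rewrite -bigcup_seq; apply/seteqP; split => // w _.
  by exists (T w) => //=; exact: mem_index_enum.
rewrite [in LHS]E ge0_integral_bigsetU//.
- apply: eq_bigr => t _; rewrite -integral_cst//.
  by apply: eq_integral => w; rewrite inE => ->.
- exact: index_enum_uniq.
- by move=> s t _ _ [w [<- <-]].
- by rewrite -E; exact: measurable_finite_range.
Qed.

End FiniteRange.

Lemma integral_borel {R : realType} {X : finMetricType R}
    (mu : {measure set (borel X) -> \bar R}) (H : X -> \bar R) :
  (forall x, 0 <= H x)%E ->
  (\int[mu]_(y in [set: borel X]) H y = \sum_y H y * mu [set y])%E.
Proof.
move=> H0.
by rewrite (@integral_finite_range _ (borel X) X id)// => t; exact: borel_measurable.
Qed.

Section RealMass.
Context {R : realType} {X : finMetricType R}.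
Variable mu : {measure set (borel X) -> \bar R}.
Hypothesis muT : mu setT = 1%E.

(** [fine] would send an infinite value to 0; total mass 1 excludes this, as [massE] records. *)
Definition mass (y : X) : R := fine (mu [set y]).

Lemma massE y : mu [set y] = (mass y)%:E.
Proof.
rewrite /mass fineK// ge0_fin_numE//.
apply: (@le_lt_trans _ _ (mu setT)); last by rewrite muT ltry.
by apply: le_measure; rewrite ?inE//; exact: borel_measurable.
Qed.

Lemma mass_ge0 y : 0 <= mass y.
Proof. exact: fine_ge0. Qed.

Lemma sum_mass : \sum_y mass y = 1.
Proof.
have := integral_borel mu (cst 1%E) (fun=> lee01).
rewrite integral_cst// mul1e muT => /esym.
by under eq_bigr do rewrite mul1e massE; rewrite sumEFin => -[].
Qed.

Lemma integral_mass (f : X -> R) : (forall x, 0 <= f x) ->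
  (\int[mu]_(y in [set: borel X]) (f y)%:E = (\sum_y f y * mass y)%:E)%E.
Proof.
move=> f0; rewrite (integral_borel mu (fun y => (f y)%:E))//.
by under eq_bigr do rewrite massE -EFinM; rewrite sumEFin.
Qed.

End RealMass.

Section RealKernel.
Context {R : realType} {X : finMetricType R}.
Variable P : R.-pker (borel X) ~> (borel X).

Definition kernel_matrix (x y : X) : R := mass (P x) y.

(** Both recursions split off the first step. This carries irreducibility of the kernel over to the
    matrix. *)
Lemma kiter_transition n x y :
  kiter P n x [set y] = (transition kernel_matrix n x y)%:E.
Proof.
elim: n x => [|n IHn] x /=.
  by rewrite diracE (classical_sets.in_set1 (y : X)).
under eq_integral do rewrite IHn.
rewrite (integral_mass (P x) (prob_kernel x) (fun z => transition _ n z y)).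
  by congr EFin; apply: eq_bigr => z _; rewrite mulrC.
by move=> z; apply: transition_ge0 => *; exact: mass_ge0.
Qed.

Lemma stationary_invariant (nu : probability (borel X) R) :
  stationary P nu -> left_invariant kernel_matrix (mass nu).
Proof.
have nuT : (nu : {measure set (borel X) -> \bar R}) setT = 1%E.
  exact: probability_setT.
move=> st y; have := st [set y] (borel_measurable _ _).
have -> : nu [set y] = (mass nu y)%:E := massE nu nuT y.
under eq_integral do rewrite (massE _ (prob_kernel _)).
rewrite (integral_mass nu nuT (kernel_matrix^~ y)); last first.
  by move=> x; exact: mass_ge0.
by move=> [->]; apply: eq_bigr => x _; rewrite mulrC.
Qed.

End RealKernel.

(** * Second moment of the compensated visit counts *)

Section Increments.
Context {d : measure_display} {Omega : measurableType d} {R : realType}.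
Context {X : finType}.
Variables (Pr : probability Omega R) (Y : nat -> Omega -> X) (p : X -> X -> R).
Hypothesis mY : forall n x, measurable (Y n @^-1` [set x]).
Hypothesis p_ge0 : forall x y, 0 <= p x y.
Hypothesis p_le1 : forall x y, p x y <= 1.
Hypothesis markov : forall n (x : nat -> X) z,
  (Pr [set w | (forall i, (i <= n)%N -> Y i w = x i) /\ Y n.+1 w = z] =
   Pr [set w | forall i, (i <= n)%N -> Y i w = x i] * (p (x n) z)%:E)%E.
Variable z : X.

Definition martingale (n : nat) (w : Omega) : R :=
  \sum_(i < n) ((Y i.+1 w == z)%:R - p (Y i w) z).

(** The history up to time [n] takes finitely many values, so expectations become finite sums over
    histories. *)
Let path n w : {ffun 'I_n.+1 -> X} := [ffun i : 'I_n.+1 => Y i w].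

(** [martingale n] read off a history: [lift ord0 i] is time [i + 1] and [widen_ord] keeps time
    [i]. *)
Let s n (t : {ffun 'I_n.+1 -> X}) : R :=
  \sum_(i < n) ((t (lift ord0 i) == z)%:R - p (t (widen_ord (leqnSn n) i)) z).

Let martingale_path n w : martingale n w = s n (path n w).
Proof. by apply: eq_bigr => i _; rewrite !ffunE. Qed.

Let pathE n t : path n @^-1` [set t] =
  [set w | forall i, (i <= n)%N -> Y i w = t (inord i)].
Proof.
apply/seteqP; split => w /=.
  by move=> <- i ilen; rewrite ffunE inordK.
move=> Yt; apply/ffunP => i; rewrite ffunE Yt ?inord_val//.
by rewrite -ltnS.
Qed.

Let measurable_path n t : measurable (path n @^-1` [set t]).
Proof.
rewrite (_ : _ @^-1` _ = \bigcap_(i : 'I_n.+1) (Y i @^-1` [set t i])).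
  by apply: fin_bigcap_measurable => // i _; exact: mY.
apply/seteqP; split => [w <- i _|w wt] /=; first by rewrite ffunE.
by apply/ffunP => i; rewrite ffunE; exact: wt.
Qed.

(** The history with one further bit, which is all that the next increment depends on. *)
Let step n w := (path n w, Y n.+1 w == z).

Let stepE n t b : step n @^-1` [set (t, b)] =
  path n @^-1` [set t] `&`
    (if b then Y n.+1 @^-1` [set z] else ~` (Y n.+1 @^-1` [set z])).
Proof.
apply/seteqP; split => w /=.
  by move=> [<- <-]; split => //; case: eqP => /=.
by case: b => -[<- /eqP Yz]; congr pair; [exact: Yz|exact: negbTE].
Qed.

Let measurable_step n u : measurable (step n @^-1` [set u]).
Proof.
case: u => t b; rewrite stepE; apply: measurableI => //.
by case: b; [|apply: measurableC]; exact: mY.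
Qed.

Let q n t : R := fine (Pr (path n @^-1` [set t])).

Let qE n t : Pr (path n @^-1` [set t]) = (q n t)%:E.
Proof. by rewrite fineK// fin_num_measure. Qed.

Let step_true n t :
  Pr (step n @^-1` [set (t, true)]) = (p (t ord_max) z * q n t)%:E.
Proof.
rewrite stepE pathE.
(* [markov] asks for a sequence on all of [nat]; [inord] extends [t], and only the indices up to [n]
   matter. *)
have := markov n (fun i => t (inord i)) z.
rewrite -pathE qE -EFinM mulrC (_ : inord n = ord_max); last first.
  by apply/val_inj; rewrite /= inordK.
by move=> <-; congr (Pr _); rewrite pathE; apply/seteqP; split.
Qed.

Let step_false n t :
  Pr (step n @^-1` [set (t, false)]) = ((1 - p (t ord_max) z) * q n t)%:E.
Proof.
have : Pr (path n @^-1` [set t]) = (Pr (step n @^-1` [set (t, true)]) +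
    Pr (step n @^-1` [set (t, false)]))%E.
  rewrite -measureU//; last first.
    by rewrite !stepE setIACA setICr setI0.
  by congr (Pr _); rewrite !stepE -setIUr setUv setIT.
rewrite qE step_true.
have : Pr (step n @^-1` [set (t, false)]) \is a fin_num by exact: fin_num_measure.
move=> /fineK <-; rewrite -EFinD => -[e]; congr EFin; rewrite mulrBl mul1r.
by rewrite {1}e addrAC subrr add0r.
Qed.

Lemma measurable_martingale_sqr n (c : R) :
  measurable_fun setT (fun w => (martingale n w ^+ 2 * c)%:E).
Proof.
under eq_fun do rewrite martingale_path.
exact: (measurable_finite_range (path n) (measurable_path n)
  (fun t => (s n t ^+ 2 * c)%:E)).
Qed.

Let integral_path n (H : {ffun 'I_n.+1 -> X} -> R) : (forall t, 0 <= H t) ->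
  (\int[Pr]_w (H (path n w))%:E = (\sum_t H t * q n t)%:E)%E.
Proof.
move=> H0; rewrite (integral_finite_range _ (measurable_path n) _ (EFin \o H))//=.
by under eq_bigr do rewrite qE -EFinM; rewrite sumEFin.
Qed.

Let sum_q n : \sum_t q n t = 1.
Proof.
apply: EFin_inj; rewrite -(probability_setT Pr) -[RHS]mul1e -integral_cst//.
rewrite (integral_path n (fun=> 1))//; congr EFin.
by apply: eq_bigr => t _; rewrite mul1r.
Qed.

(** Induction on [n]. With the history fixed, averaging over the next bit cancels the cross term
    between [s n t] and the increment, leaving the variance [p (1 - p)], which is at most 1. *)
Lemma martingale_sqr n : (\int[Pr]_w (martingale n w ^+ 2)%:E <= n%:R%:E)%E.
Proof.
under eq_integral do rewrite martingale_path.
rewrite (integral_path n (fun t => s n t ^+ 2)); last by move=> t; exact: sqr_ge0.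
rewrite lee_fin; elim: n => [|n IHn].
  by rewrite big1// => t _; rewrite /s big_ord0 expr0n mul0r.
rewrite -lee_fin -(integral_path n.+1 (fun t => s n.+1 t ^+ 2)); last first.
  by move=> t; exact: sqr_ge0.
pose H (u : {ffun 'I_n.+1 -> X} * bool) :=
  ((s n u.1 + (u.2%:R - p (u.1 ord_max) z)) ^+ 2)%:E.
rewrite (_ : integral _ _ _ = (\int[Pr]_w H (step n w))%E); last first.
  apply: eq_integral => w _; rewrite -martingale_path /H /= -martingale_path.
  by rewrite /martingale big_ord_recr/= ffunE.
rewrite (integral_finite_range _ (measurable_step n)); last first.
  by move=> u; rewrite lee_fin sqr_ge0.
have -> : (\sum_u H u * Pr (step n @^-1` [set u]) =
    \sum_t \sum_b H (t, b) * Pr (step n @^-1` [set (t, b)]))%E.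
  by rewrite pair_bigA; apply: eq_bigr => -[].
under eq_bigr do rewrite big_bool /H /= step_true step_false -!EFinM -EFinD.
rewrite sumEFin lee_fin -[leRHS]natr1; apply: le_trans (lerD IHn (lexx 1)).
(* The added 1 is spread out as the total mass of [q n], so that the bound can be checked history by
   history. *)
rewrite -[in leRHS](sum_q n) -big_split/=; apply: ler_sum => t _.
rewrite [leLHS](_ : _ = s n t ^+ 2 * q n t +
  p (t ord_max) z * (1 - p (t ord_max) z) * q n t); last by ring.
(* Given the path, the increment is a centred Bernoulli variable. *)
rewrite lerD2l ler_piMl// ?fine_ge0//.
by have := p_ge0 (t ord_max) z; have := p_le1 (t ord_max) z; nra.
Qed.

Lemma martingale_lipschitz n w : `|martingale n.+1 w - martingale n w| <= 1.
Proof.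
rewrite /martingale big_ord_recr/= addrAC subrr add0r.
have := p_ge0 (Y n w) z; have := p_le1 (Y n w) z.
by case: (Y n.+1 w == z); rewrite ?mulr1n ?mulr0n ler_norml; lra.
Qed.

End Increments.

(** * Strong law for the compensated visit counts *)

Lemma sum_inv_sqr_le {R : realFieldType} n :
  \sum_(0 <= k < n) (k.+1%:R ^- 2 : R) <= 2.
Proof.
case: n => [|n]; first by rewrite big_nil.
(* The correction [1 / (n + 1)] lets the induction close: with [m = n + 1] the slack of a step is
   [1 / (m (m + 1)^2)]. *)
have : \sum_(0 <= k < n.+1) (k.+1%:R ^- 2 : R) <= 2 - n.+1%:R^-1.
  elim: n => [|n IHn]; first by rewrite big_nat1 expr1n invr1; lra.
  rewrite big_nat_recr//=; apply: le_trans (lerD IHn (lexx _)) _.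
  have n0 : (0 : R) < n.+1%:R by rewrite ltr0n.
  rewrite -(natr1 n.+1); set m : R := n.+1%:R in n0 *.
  have m0 : 0 < m + 1 by lra.
  rewrite -subr_ge0 (_ : _ - _ = (m * (m + 1) ^+ 2)^-1).
    by rewrite invr_ge0 mulr_ge0 ?sqr_ge0// ltW.
  by field; rewrite !gt_eqF.
by move=> /le_trans; apply; rewrite gerBl invr_ge0 ler0n.
Qed.

(** The integral of the series of the [f k] is at most [M], so the series is finite almost
    everywhere, and the terms of a convergent series tend to 0. *)
Lemma ae_cvg0_summable {d} {Omega : measurableType d} {R : realType}
    (mu : {measure set Omega -> \bar R}) (f : nat -> Omega -> R) (a : nat -> R)
    (M : R) :
  (forall n, measurable_fun setT (fun w => (f n w)%:E)) ->
  (forall n w, 0 <= f n w) ->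
  (forall n, (\int[mu]_w (f n w)%:E <= (a n)%:E)%E) ->
  (forall n, \sum_(0 <= k < n) a k <= M) ->
  {ae mu, forall w, f n w @[n --> \oo] --> 0}.
Proof.
move=> mf f0 fa aM.
pose g w := (\sum_(0 <= k <oo) (f k w)%:E)%E.
have g0 w : (0 <= g w)%E by apply: nneseries_ge0 => k _ _; rewrite lee_fin.
have ig : mu.-integrable setT g.
  apply/integrableP; split.
    by apply: ge0_emeasurable_sum => // k w _ _; rewrite lee_fin.
  under eq_integral do rewrite gee0_abs//.
  rewrite integral_nneseries//; last by move=> n w _; rewrite lee_fin.
  apply: (@le_lt_trans _ _ M%:E); last exact: ltry.
  apply: lime_le.
    by apply: is_cvg_nneseries => n _ _; apply: integral_ge0 => w _; rewrite lee_fin.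
  apply: nearW => n; apply: (@le_trans _ _ (\sum_(0 <= k < n) (a k)%:E)%E).
    exact: lee_sum.
  by rewrite sumEFin lee_fin.
have := integrable_ae measurableT ig; apply: filterS => w /(_ I) gw.
apply: cvg_series_cvg_0; apply: nondecreasing_is_cvgn.
  by apply/nondecreasing_seqP => n; rewrite seriesSr/= lerDl.
exists (fine (g w)) => _ [n _ <-].
rewrite -lee_fin fineK// /series/= -sumEFin.
by apply: nneseries_lim_ge => k _ _; rewrite lee_fin.
Qed.

Lemma sqrt_bracket n : (0 < n)%N -> exists k, (k.+1 ^ 2 <= n < k.+2 ^ 2)%N.
Proof.
elim: n => // -[_ _|n /(_ isT)[k kn] _]; first by exists 0%N.
case: (ltnP n.+2 (k.+2 ^ 2)%N) => nk.
  by exists k; rewrite nk andbT; lia.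
by exists k.+1; rewrite nk /=; lia.
Qed.

Lemma lipschitz_dist {R : numDomainType} (s : nat -> R) m n :
  (forall n, `|s n.+1 - s n| <= 1) -> (m <= n)%N ->
  `|s n - s m| <= (n - m)%:R.
Proof.
move=> s1 /subnKC <-; rewrite addKn; elim: (n - m)%N => [|k IHk].
  by rewrite addn0 subrr normr0.
rewrite addnS -natr1 [leRHS]addrC -(subrKA (s (m + k)%N)).
exact: le_trans (ler_normD _ _) (lerD (s1 _) IHk).
Qed.

(* Any [n] lies between consecutive squares [k.+1 ^ 2] and [k.+2 ^ 2], hence
   within [2 * k.+1 <= 2 * sqrt n] of the first. *)
Lemma lipschitz_cvg0 {R : realType} (s : nat -> R) :
  (forall n, `|s n.+1 - s n| <= 1) ->
  s (n.+1 ^ 2)%N / n.+1%:R ^+ 2 @[n --> \oo] --> 0 ->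
  s n / n%:R @[n --> \oo] --> 0.
Proof.
move=> s1 /cvgr0Pnorm_lt sq; apply/cvgr0Pnorm_le => e e0.
have e20 : 0 < e / 2 by rewrite divr_gt0.
have [K _ sK] := sq _ e20.
(* Once [k + 1] is at least [4 / e], the gap [2 (k + 1)] is at most [e / 2 * (k + 1)^2]; the other
   [e / 2] comes from [sK]. *)
have [L LP] : exists L : nat, 4 / e <= L%:R.
  by exists (Num.bound (4 / e)); rewrite ltW// archi_boundP// divr_ge0// ltW.
exists ((maxn K L).+1 ^ 2)%N => // n /= Kn.
have n0 : (0 < n)%N by apply: leq_trans Kn; rewrite expn_gt0.
have [k /andP[kn nk]] := sqrt_bracket n n0.
have kKL : (maxn K L <= k)%N.
  by rewrite -ltnS -ltnS -(@ltn_exp2r _ k.+2 2)// (leq_ltn_trans Kn nk).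
have /= skb := sK k (leq_trans (leq_maxl _ _) kKL).
have d : `|s n - s (k.+1 ^ 2)%N| <= 2 * k.+1%:R.
  rewrite (le_trans (lipschitz_dist _ _ _ s1 kn))// -natrM ler_nat; nia.
have Lk : 4 / e <= k.+1%:R.
  by rewrite (le_trans LP)// ler_nat (leq_trans (leq_maxr K L))// leqW.
have k0 : (0 : R) < k.+1%:R by rewrite ltr0n.
have kn' : k.+1%:R ^+ 2 <= n%:R :> R by rewrite -natrX ler_nat.
rewrite normrM normfV (ger0_norm (ler0n _ n)) ler_pdivrMr ?ltr0n//.
move: skb; rewrite normrM normfV (ger0_norm (ltW (exprn_gt0 _ k0))).
rewrite ltr_pdivrMr ?exprn_gt0// => skb.
have := ler_normD (s n - s (k.+1 ^ 2)%N) (s (k.+1 ^ 2)%N); rewrite subrK => tri.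
rewrite ler_pdivrMr// in Lk.
have : 2 * k.+1%:R <= e / 2 * k.+1%:R ^+ 2 by nra.
have : e * k.+1%:R ^+ 2 <= e * n%:R by rewrite ler_pM2l.
lra.
Qed.

Lemma martingale_lln {d} {Omega : measurableType d} {R : realType} {X : finType}
    (Pr : probability Omega R) (Y : nat -> Omega -> X) (p : X -> X -> R) (z : X) :
  (forall n x, measurable (Y n @^-1` [set x])) ->
  (forall x y, 0 <= p x y) -> (forall x y, p x y <= 1) ->
  (forall n (x : nat -> X) z,
    (Pr [set w | (forall i, (i <= n)%N -> Y i w = x i) /\ Y n.+1 w = z] =
     Pr [set w | forall i, (i <= n)%N -> Y i w = x i] * (p (x n) z)%:E)%E) ->
  {ae Pr, forall w, martingale Y p z n w / n%:R @[n --> \oo] --> 0}.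
Proof.
move=> mY p_ge0 p_le1 markov.
(* With [N = (k + 1)^2] this is [1 / N^2]. The second moment of [M_N / N] is then at most [1 / N],
   which is summable in [k]. *)
pose c k : R := (k.+1%:R ^+ 2) ^- 2.
have mM k (a : R) : measurable_fun setT
    (fun w => (martingale Y p z (k.+1 ^ 2)%N w ^+ 2 * a)%:E).
  exact: measurable_martingale_sqr.
have c0 k : 0 <= c k by rewrite invr_ge0 exprn_ge0// exprn_ge0.
have : {ae Pr, forall w,
    martingale Y p z (k.+1 ^ 2)%N w ^+ 2 * c k @[k --> \oo] --> 0}.
  apply: (@ae_cvg0_summable _ _ _ Pr (fun k w => _) (fun k => k.+1%:R ^- 2) 2).
  - by move=> k; exact: mM.
  - by move=> k w; rewrite mulr_ge0// sqr_ge0.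
  - move=> k; under eq_integral do rewrite EFinM.
    rewrite ge0_integralZr//; last first.
    - by rewrite lee_fin.
    - by move=> w _; rewrite lee_fin sqr_ge0.
    - by under eq_fun do rewrite -[_ ^+ 2]mulr1; exact: mM.
    apply: le_trans.
      by apply: lee_wpmul2r; [rewrite lee_fin|exact: martingale_sqr].
    rewrite -EFinM lee_fin natrX /c [(_ ^+ 2) ^+ 2]expr2 invfM.
    by rewrite mulVKf ?lexx// expf_neq0// pnatr_eq0.
  - exact: sum_inv_sqr_le.
apply: filterS => w /cvgr0Pnorm_lt sq0.
apply: lipschitz_cvg0 => [n|]; first exact: martingale_lipschitz.
apply/cvgr0Pnorm_lt => e e0; have := sq0 _ (exprn_gt0 2 e0).
apply: filterS => n; rewrite /c -exprVn -exprMn normrX.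
by rewrite ltr_pXn2r// ?nnegrE// ltW.
Qed.

(** * Limits of occupation frequencies and stability of minimisers *)

Lemma occupation_cvg {R : realType} {X : finType} (p : X -> X -> R)
    (pi : X -> R) (y : nat -> X) :
  (forall x z, 0 <= p x z) -> (forall x, \sum_z p x z = 1) ->
  (forall x z, exists n, 0 < transition p n x z) ->
  left_invariant p pi -> \sum_x pi x = 1 ->
  (forall z, (\sum_(i < n) ((y i.+1 == z)%:R - p (y i) z)) / n%:R
     @[n --> \oo] --> 0) ->
  forall x, n%:R^-1 * (\sum_(i < n) (y i == x)%:R) @[n --> \oo] --> pi x.
Proof.
move=> p_ge0 p_sum1 p_irr pi_inv pi_sum lln x.
have [b bE] := fundamental_matrix p p_ge0 p_sum1 p_irr.
pose f n x : R := n%:R^-1 * (\sum_(i < n) (y i == x)%:R).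
(* The residual of [f n] under [1 - p]. It is also the residual of [f n - pi], since [pi] is
   invariant, so [b] turns it into the error. *)
pose r n z := f n z - \sum_x f n x * p x z.
(* Shifting the visit count from times [i] to [i + 1] costs only a boundary term; the rest is the
   normalised martingale. *)
have rE n z : r n z = (\sum_(i < n) ((y i.+1 == z)%:R - p (y i) z)) / n%:R +
    ((y 0%N == z)%:R - (y n == z)%:R) / n%:R.
  rewrite /r; have -> : \sum_x f n x * p x z = n%:R^-1 * \sum_(i < n) p (y i) z.
    under eq_bigr do rewrite -mulrA mulr_suml.
    rewrite -mulr_sumr exchange_big/=; congr (_ * _); apply: eq_bigr => i _.
    rewrite (bigD1 (y i))//= eqxx mul1r big1 ?addr0// => u.
    by rewrite eq_sym => /negbTE ->; rewrite mul0r.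
  have -> : f n z = n%:R^-1 * (\sum_(i < n) (y i.+1 == z)%:R +
      ((y 0%N == z)%:R - (y n == z)%:R)).
    rewrite /f; congr (_ * _).
    elim: n => [|n IHn]; first by rewrite !big_ord0 add0r subrr.
    by rewrite !big_ord_recr/= IHn; ring.
  by rewrite sumrB; ring.
have r0 z : r n z @[n --> \oo] --> 0.
  under eq_fun do rewrite rE.
  suff d0 : ((y 0%N == z)%:R - (y n == z)%:R) / n%:R @[n --> \oo] --> (0 : R).
    have h := cvgD (lln z) d0; rewrite addr0 in h; exact: h.
  apply/cvgr0Pnorm_le => e e0.
  have := nbhs_infty_gtr e^-1; apply: filterS => n en.
  have n0 : 0 < n%:R :> R by apply: lt_trans en; rewrite invr_gt0.
  rewrite normrM normfV (ger0_norm (ler0n _ n)) ler_pdivrMr//.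
  apply: (@le_trans _ _ 1).
    by case: (y 0%N == z); case: (y n == z); rewrite ?mulr1n ?mulr0n ler_norml; lra.
  by rewrite -ler_pdivrMl// mulr1 ltW.
have s0 : \sum_z r n z * b z x @[n --> \oo] --> \sum_(z : X) 0 * b z x.
  apply: cvg_big => [|z _]; first exact: add_continuous.
  by apply: cvgM; [exact: r0|exact: cvg_cst].
rewrite big1 in s0; last by move=> z _; rewrite mul0r.
rewrite -[pi x]add0r; apply: cvg_trans (cvgD s0 (cvg_cst (pi x))).
apply: near_eq_cvg; near=> n.
(* At [n = 0] all frequencies are 0, so they sum to 1 only for positive [n]. *)
have n0 : (0 < n)%N by near: n; exact: nbhs_infty_gt.
have v0 : \sum_x (f n x - pi x) = 0.
  rewrite sumrB pi_sum -mulr_sumr exchange_big/=.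
  under eq_bigr => i _.
    rewrite (bigD1 (y i))//= eqxx big1 ?addr0; last first.
      by move=> u; rewrite eq_sym => /negbTE ->.
    over.
  by rewrite sumr_const card_ord mulVf ?subrr// pnatr_eq0 -lt0n.
rewrite /= -[RHS](subrK (pi x)) (bE _ v0 x); congr (_ + _).
apply: eq_bigr => z _; congr (_ * _); rewrite /r.
under [in RHS]eq_bigr do rewrite mulrBl.
by rewrite sumrB pi_inv; ring.
Unshelve. all: by end_near. Qed.

(** Each strict inequality [g z < g x] passes to [f n] for large [n]. There are finitely many pairs,
    so eventually every point that does not minimise [g] is beaten under [f n] as well. *)
Lemma near_argmin_subset {R : realType} {X : finType} (f : nat -> X -> R)
    (g : X -> R) :
  (forall x, f n x @[n --> \oo] --> g x) ->
  \forall n \near \oo, [set x | forall z, f n x <= f n z] `<=`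
    [set x | forall z, g x <= g z].
Proof.
move=> fg.
have : \forall n \near \oo, forall u : X * X, g u.2 < g u.1 -> f n u.2 < f n u.1.
  apply: filter_forall => -[x z] /=.
  case: (ltP (g z) (g x)) => zx; last exact: nearW.
  have : \forall n \near \oo, 0 < f n x - f n z.
    by apply: (cvgr_gt _ (cvgB (fg x) (fg z))); rewrite subr_gt0.
  by apply: filterS => n; rewrite subr_gt0.
apply: filterS => n fn x xmin z; rewrite leNgt; apply/negP => zx.
by have := fn (x, z) zx; rewrite ltNge xmin.
Qed.

(** * Frechet means as sets of minimisers of finite sums *)

Section Frechet.
Context {R : realType} {X : finMetricType R}.

(** Each point of [C] is its own nearest point in [C']. Non-emptiness keeps the outer maximum from
    being [-oo]. *)
Lemma rho_subset (C C' : set X) : C !=set0 -> C `<=` C' -> rho C C' = 0%E.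
Proof.
move=> [x Cx] CC'.
have inner u : u \in C ->
    (\big[mine/+oo]_(v in C') (mdist u v)%:E = 0)%E.
  move=> uC; apply/eqP; rewrite eq_le; apply/andP; split.
    apply: (@bigmin_inf _ _ _ _ u); last by rewrite mdistxx.
    by apply/mem_set/CC'/set_mem.
  by apply: le_bigmin => [|v _]; rewrite ?lee_fin ?mdist_ge0// leey.
rewrite /rho (eq_bigr (fun=> 0%E)) //.
apply/eqP; rewrite eq_le; apply/andP; split.
  by apply: bigmax_le => //; exact: leNye.
by apply: (@bigmax_sup _ _ _ _ x) => //; exact/mem_set.
Qed.

Lemma argmin_nonempty (g : X -> R) : [set x | forall z, g x <= g z] !=set0.
Proof.
case: (@Order.TotalTheory.arg_minP _ _ X point xpredT g isT) => x _ xmin.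
by exists x => z; exact: xmin.
Qed.

(** Taking weights instead of a measure makes this a finite linear expression, through which
    convergence of masses passes term by term. *)
Definition frechet_functional (p : R) (m : X -> R) (x : X) : R :=
  \sum_y (mdist x y) `^ p * m y.

Lemma frechet_meanE (p : R) (mu : {measure set (borel X) -> \bar R}) :
  mu setT = 1%E ->
  frechet_mean p mu = [set x | forall z,
    frechet_functional p (mass mu) x <= frechet_functional p (mass mu) z].
Proof.
move=> muT.
have E x : (\int[mu]_(y in [set: borel X]) ((mdist x (y : X) : R) `^ p)%:E =
    (frechet_functional p (mass mu) x)%:E)%E.
  rewrite (integral_mass mu muT (fun y => (mdist x y : R) `^ p))// => y.
  exact: powR_ge0.
by apply/seteqP; split => x xmin z; have := xmin z; rewrite ?E lee_fin.
Qed.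

Lemma empirical_mass (y : nat -> X) n x :
  mass (empirical y n) x = n%:R^-1 * \sum_(i < n) (y i == x)%:R.
Proof.
rewrite /mass /empirical /= /mscale /= /msum.
rewrite (eq_bigr (fun i : 'I_n => (y i == x)%:R%:E)) ?sumEFin -?EFinM// => i _.
by rewrite -(classical_sets.in_set1 x); exact: diracE.
Qed.

Lemma empiricalT (y : nat -> X) n : (0 < n)%N -> empirical y n setT = 1%E.
Proof.
move=> n0; rewrite /empirical /= /mscale /= /msum.
rewrite (eq_bigr (fun=> 1%:E)) => [|i _]; last exact: diracT.
rewrite sumEFin -EFinM sumr_const card_ord mulVf// pnatr_eq0.
by rewrite -lt0n.
Qed.

End Frechet.

(** * Almost sure convergence of the empirical Frechet means *)

Local Open Scope ereal_scope.

Theorem theorem4p11 (R : realType) (p : R) (hp : (1 <= p)%R)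
  (X : finMetricType R)
  (P : R.-pker (borel X) ~> (borel X))
  (hirr : irreducible P) (haper : aperiodic P)
  (nuoo : probability (borel X) R) (hstat : stationary P nuoo)
  (nu : probability (borel X) R)
  (d : measure_display) (Omega : measurableType d) (Pr : probability Omega R)
  (Y : nat -> {RV Pr >-> borel X}) (hY : markov_chain P Y nu) :
  {ae Pr, forall w,
    rho (frechet_mean p (empirical (fun i => Y i w) n)) (frechet_mean p nuoo)
      @[n --> \oo] --> 0}.
Proof.
pose k : X -> X -> R := kernel_matrix P.
have k_ge0 x z : (0 <= k x z)%R by exact: mass_ge0.
have k_sum1 x : (\sum_z k x z = 1)%R by apply: sum_mass; exact: prob_kernel.
have k_le1 x z : (k x z <= 1)%R.
  by rewrite -(k_sum1 x) (bigD1 z)//= lerDl sumr_ge0.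
have k_irr x z : exists n, (0 < transition k n x z)%R.
  by have [n _] := hirr x z; rewrite kiter_transition lte_fin; exists n.
have nuT : (nuoo : {measure set (borel X) -> \bar R}) setT = 1.
  exact: probability_setT.
pose Y' (i : nat) (w : Omega) : X := Y i w.
have mY i x : measurable (Y' i @^-1` [set x]).
  rewrite -[X in measurable X]setTI.
  by apply: measurable_funPT => //; exact: borel_measurable.
have lln : {ae Pr, forall w, forall z : X,
    (martingale Y' k z n w / n%:R)%R @[n --> \oo] --> (0 : R)%R}.
  (* Finitely many states [z] give finitely many null sets, so one almost sure event serves them
     all. *)
  apply: filter_forall => z; apply: martingale_lln => // n x u.
  have [_ ->] := hY; congr (_ * _).
  by rewrite (massE _ (prob_kernel _)).
apply: filterS lln => w lln.
have mass_cvg y : mass (empirical (Y'^~ w) n) y @[n --> \oo] --> mass nuoo y.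
  under eq_fun do rewrite empirical_mass.
  exact: (occupation_cvg k (mass nuoo) (Y'^~ w) k_ge0 k_sum1 k_irr
    (stationary_invariant P nuoo hstat) (sum_mass nuoo nuT) lln).
have functional_cvg x :
    frechet_functional p (mass (empirical (Y'^~ w) n)) x @[n --> \oo] -->
    frechet_functional p (mass nuoo) x.
  apply: cvg_big => [|y _]; first exact: add_continuous.
  by apply: cvgM; [exact: cvg_cst|exact: mass_cvg].
(* The sequence is eventually equal to 0. Large [n] also ensures [n > 0], where the empirical
   measure has mass 1. *)
apply: cvg_near_cst; near=> n; apply: rho_subset.
  rewrite frechet_meanE; first exact: argmin_nonempty.
  by apply: empiricalT; near: n; exact: nbhs_infty_gt.
rewrite !frechet_meanE//; first by near: n; exact: near_argmin_subset.
by apply: empiricalT; near: n; exact: nbhs_infty_gt.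
Unshelve. all: by end_near. Qed.
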